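(* The following statements hold for symplectic manifolds and Lagrangian relations between them (with set-theoretic composition): (1) For $L_1\in\mathrm{Hom}(M,A)$, $L_2\in\mathrm{Hom}(N,B)$, $L_3\in\mathrm{Hom}(A,X)$ and $L_4\in\mathrm{Hom}(B,Y)$, one has the equality of sets $$(L_3\otimes L_4)\circ(L_1\otimes L_2)=(L_3\circ L_1)\otimes(L_4\circ L_2).$$ (2) $\mathrm{id}_M\otimes\mathrm{id}_N=\mathrm{id}_{M\otimes N}$ for any objects $M$ and $N$. (3) $(M\otimes A)\otimes X=M\otimes(A\otimes X)$ for any objects $M$, $A$, $X$. (4) $(L_1\otimes L_2)\otimes L_3=L_1\otimes(L_2\otimes L_3)$ for any $L_1\in\mathrm{Hom}(M,A)$, $L_2\in\mathrm{Hom}(N,B)$, $L_3\in\mathrm{Hom}(P,C)$. (5) $\{*\}\otimes A\simeq A\simeq A\otimes\{*\}$ for every object $A$, and $\mathrm{id}_{\{*\}}\otimes L\simeq L\simeq L\otimes\mathrm{id}_{\{*\}}$ for every arrow $L$, where $A\simeq B$ means that the two sets $A$ and $B$ are in bijection.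
   Context: The extended symplectic ''category'' has as objects the symplectic manifolds and as morphisms $\mathrm{Hom}(M,N)=\{L\subset\overline M\times N: L\text{ is Lagrangian}\}$, where $\overline M$ is $M$ with the opposite symplectic structure. The identity of $M$ is the diagonal $\mathrm{id}_M=\Delta_M=\{(m,m):m\in M\}\subset\overline M\times M$. For $L\in\mathrm{Hom}(M,N)$ and $\tilde L\in\mathrm{Hom}(N,P)$ the composition is the set $$\tilde L\circ L:=\pi_{M\times P}\big((L\times\tilde L)\cap(M\times\Delta_N\times P)\big)\subset\overline M\times P,$$ which may fail to be a Lagrangian submanifold. The tensor product of objects is $M\otimes N:=M\times N$, and for $L_1\in\mathrm{Hom}(M,N)$, $L_2\in\mathrm{Hom}(A,B)$, $$L_1\otimes L_2:=\{(m,a,n,b):(m,n)\in L_1\text{ and }(a,b)\in L_2\}\subset\overline{(M\times A)}\times(N\times B).$$ The same formulas define $\circ$ and $\otimes$ for arbitrary subsets (relations). $\{*\}$ is the one-point symplectic manifold. Iterated Cartesian products are identified by re-bracketing, so that the equalities in (3) and (4) are meant up to this identification. *)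

(* Defs.v *)
From HB Require Import structures.
From mathcomp Require Import all_boot all_order all_algebra.
From mathcomp Require Import all_classical all_reals all_analysis.

Set Implicit Arguments.
Unset Strict Implicit.
Unset Printing Implicit Defensive.

Import Order.TTheory GRing.Theory Num.Theory.
Import numFieldNormedType.Exports.
Local Open Scope classical_set_scope.
Local Open Scope ring_scope.

Definition iter_derive (R : realType) (V W : normedModType R)
    (f : V -> W) (vs : seq V) : V -> W :=
  foldr (fun v g => 'D_v g) f vs.

(* C^oo on the open set U: all iterated directional derivatives exist and are
   continuous. *)
Definition smooth_on (R : realType) (V W : normedModType R)
    (U : set V) (f : V -> W) : Prop :=
  forall (vs : seq V) (x : V), U x ->
    {for x, continuous (iter_derive f vs)} /\
    forall v, derivable (iter_derive f vs) x v.

(* A chart is a homeomorphism from an open subset of T onto an open subset of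
   R^n; the values of the two maps outside these sets are irrelevant. *)
Record chart (R : realType) (T : topologicalType) (n : nat) := Chart {
  chart_source : set T;
  chart_fun : T -> 'rV[R]_n;
  chart_inv : 'rV[R]_n -> T;
  chart_source_open : open chart_source;
  chart_target_open : open (chart_fun @` chart_source);
  chart_funK : forall p, chart_source p -> chart_inv (chart_fun p) = p;
  chart_fun_continuous :
    forall p, chart_source p -> {for p, continuous chart_fun};
  chart_inv_continuous :
    forall x, (chart_fun @` chart_source) x -> {for x, continuous chart_inv}
}.

Definition chart_target (R : realType) (T : topologicalType) (n : nat)
  (c : chart R T n) : set 'rV[R]_n := chart_fun c @` chart_source c.

Definition local_dom (R : realType) (S T : topologicalType) (m n : nat)
    (c : chart R S m) (d : chart R T n) (f : S -> T) : set 'rV[R]_m :=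
  chart_fun c @` (chart_source c `&` f @^-1` chart_source d).

Definition local_rep (R : realType) (S T : topologicalType) (m n : nat)
    (c : chart R S m) (d : chart R T n) (f : S -> T) : 'rV[R]_m -> 'rV[R]_n :=
  chart_fun d \o f \o chart_inv c.

(* The smooth structure is given by an atlas, which is not required to be
   maximal. *)
Record manifold (R : realType) := Manifold {
  carrier :> topologicalType;
  dim : nat;
  atlas_index : Type;
  atlas : atlas_index -> chart R carrier dim;
  manifold_hausdorff : hausdorff_space carrier;
  manifold_second_countable : @second_countable carrier;
  atlas_cover : forall p, exists i, chart_source (atlas i) p;
  atlas_compatible : forall i j,
    smooth_on (local_dom (atlas i) (atlas j) id)
              (local_rep (atlas i) (atlas j) id)
}.

Definition smooth_map (R : realType) (M N : manifold R) (f : M -> N) : Prop :=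
  continuous f /\
  forall i j, smooth_on (local_dom (@atlas R M i) (@atlas R N j) f)
                        (local_rep (@atlas R M i) (@atlas R N j) f).

Definition gram (R : realType) (n : nat) (A : 'M[R]_n) (v w : 'rV[R]_n) : R :=
  (v *m A *m w^T) 0 0.

(* The 2-form is given in each chart i by its matrix-valued coefficient
   function form i; form_closed is d(omega) = 0 evaluated on constant vector
   fields, and form_compatible says that the local expressions agree under the
   changes of coordinates. *)
Record symplectic_manifold (R : realType) := SymplecticManifold {
  base :> manifold R;
  form : atlas_index base -> 'rV[R]_(dim base) -> 'M[R]_(dim base);
  form_smooth : forall i v w,
    smooth_on (chart_target (atlas i)) (fun x => gram (form i x) v w : R);
  form_alternating : forall i x, chart_target (atlas i) x ->
    (form i x)^T = - form i x;
  form_nondegenerate : forall i x, chart_target (atlas i) x ->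
    form i x \in unitmx;
  form_closed : forall i x, chart_target (atlas i) x -> forall u v w,
    'D_u (fun y => gram (form i y) v w : R) x +
    'D_v (fun y => gram (form i y) w u : R) x +
    'D_w (fun y => gram (form i y) u v : R) x = 0;
  form_compatible : forall i j x, local_dom (atlas i) (atlas j) id x ->
    forall v w, gram (form i x) v w =
      gram (form j (local_rep (atlas i) (atlas j) id x))
           ('D_v (local_rep (atlas i) (atlas j) id) x)
           ('D_w (local_rep (atlas i) (atlas j) id) x)
}.

Definition symplectomorphism (R : realType) (M N : symplectic_manifold R)
    (f : M -> N) : Prop :=
  [/\ smooth_map f,
      exists g : N -> M, [/\ cancel f g, cancel g f & smooth_map g] &
      forall i j x, local_dom (@atlas R M i) (@atlas R N j) f x ->
        forall v w, gram (form i x) v w =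
          gram (form j (local_rep (atlas i) (atlas j) f x))
               ('D_v (local_rep (atlas i) (atlas j) f) x)
               ('D_w (local_rep (atlas i) (atlas j) f) x)].

Definition coord_plane (R : realType) (n : nat) (k : nat) : set 'rV[R]_n :=
  [set y | forall j : 'I_n, (k <= j)%N -> y 0 j = 0].

Definition diffeo_on (R : realType) (V W : normedModType R)
    (U : set V) (h : V -> W) : Prop :=
  [/\ open U, open (h @` U), smooth_on U h &
      exists g, (forall x, U x -> g (h x) = x) /\ smooth_on (h @` U) g].

(* In the chart i, h straightens L to R^k x {0} over the open set W. *)
Definition slice_chart (R : realType) (M : manifold R) (k : nat) (L : set M)
    (i : atlas_index M) (W : set 'rV[R]_(dim M))
    (h : 'rV[R]_(dim M) -> 'rV[R]_(dim M)) : Prop :=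
  [/\ W `<=` chart_target (atlas i), diffeo_on W h &
      forall x, W x -> L (chart_inv (atlas i) x) <-> coord_plane k (h x)].

Definition embedded_submanifold (R : realType) (M : manifold R) (k : nat)
    (L : set M) : Prop :=
  forall p, L p -> exists i W h,
    [/\ chart_source (@atlas R M i) p, W (chart_fun (atlas i) p) &
        slice_chart k L i W h].

(* In a slice chart h, the tangent space of L at x consists of the v such that
   'D_v h x lies in R^k x {0}. *)
Definition isotropic (R : realType) (M : symplectic_manifold R) (k : nat)
    (L : set M) : Prop :=
  forall (i : atlas_index M) W h, slice_chart k L i W h ->
  forall x, W x -> L (chart_inv (@atlas R M i) x) ->
  forall v w, coord_plane k ('D_v h x) -> coord_plane k ('D_w h x) ->
    gram (form i x) v w = 0.

Definition lagrangian (R : realType) (M : symplectic_manifold R)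
    (L : set M) : Prop :=
  exists k, [/\ dim M = k.*2, embedded_submanifold k L & isotropic k L].

Section SmoothTheory.
Variable R : realType.
Implicit Types V W X : normedModType R.

Lemma rate_lin_pre V W X (l : {linear V -> W}) (f : W -> X) x v :
  (fun h : R => h^-1 *: (((f \o l) \o shift x) (h *: v) - (f \o l) x)) =
  (fun h : R => h^-1 *: ((f \o shift (l x)) (h *: l v) - f (l x))).
Proof. by apply/funext => h /=; rewrite linearP. Qed.

Lemma derive_lin_pre V W X (l : {linear V -> W}) (f : W -> X) x v :
  'D_v (f \o l) x = 'D_(l v) f (l x).
Proof. by rewrite /derive rate_lin_pre. Qed.

Lemma derivable_lin_pre V W X (l : {linear V -> W}) (f : W -> X) x v :
  derivable f (l x) (l v) -> derivable (f \o l) x v.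
Proof. by rewrite /derivable rate_lin_pre. Qed.

Lemma smooth_lin_pre V W X (l : {linear V -> W}) (U : set W) (f : W -> X) :
  continuous l -> smooth_on U f -> smooth_on (l @^-1` U) (f \o l).
Proof.
move=> lc sf vs x Ux.
have E ws : iter_derive (f \o l) ws = iter_derive f (map l ws) \o l.
  elim: ws => //= w ws ->; apply/funext => y; exact: derive_lin_pre.
have [fc fd] := sf (map l vs) (l x) Ux; rewrite E; split.
  exact: (@continuous_comp _ _ _ l _ x (lc x) fc).
by move=> v; exact: (@derivable_lin_pre _ _ _ l _ x v (fd (l v))).
Qed.

Lemma is_derive_lin_post V W X (l : {linear W -> X}) (f : V -> W) x v :
  continuous l -> derivable f x v -> is_derive x v (l \o f) (l ('D_v f x)).
Proof.
move=> lc df.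
have E : (fun h : R => h^-1 *: (((l \o f) \o shift x) (h *: v) - (l \o f) x)) =
    l \o (fun h : R => h^-1 *: ((f \o shift x) (h *: v) - f x)).
  by apply/funext => h /=; rewrite linearZ_LR (linearB l).
have H : (l \o (fun h : R => h^-1 *: ((f \o shift x) (h *: v) - f x))) @ 0^'
    --> l ('D_v f x).
  exact: (cvg_comp _ _ df (lc _)).
split; first by rewrite /derivable E; apply/cvg_ex; exists (l ('D_v f x)).
by rewrite /derive E; exact/cvg_lim.
Qed.

Lemma iter_derive_ext V W (U : set V) (f g : V -> W) : open U ->
  (forall x, U x -> f x = g x) ->
  forall vs x, U x -> iter_derive f vs x = iter_derive g vs x.
Proof.
move=> oU fg; elim=> [|v vs IH] x Ux /=; first exact: fg.
apply: near_eq_derive; near=> y; apply: IH; near: y.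
exact: open_nbhs_nbhs.
Unshelve. all: by end_near. Qed.

Lemma near_eq_continuous V W (f g : V -> W) x :
  (\near x, f x = g x) -> {for x, continuous f} -> {for x, continuous g}.
Proof.
move=> fg fc; have E := nbhs_singleton fg; rewrite /prop_for /continuous_at -E.
apply: cvg_trans fc; apply: near_eq_cvg => /=.
by apply: filterS fg => y ->.
Qed.

Lemma smooth_ext V W (U : set V) (f g : V -> W) : open U ->
  (forall x, U x -> f x = g x) -> smooth_on U f -> smooth_on U g.
Proof.
move=> oU fg sf vs x Ux; have [fc fd] := sf vs x Ux.
have E : \near x, iter_derive f vs x = iter_derive g vs x.
  near=> y; apply: (iter_derive_ext oU fg); near: y; exact: open_nbhs_nbhs.
split; first exact: near_eq_continuous fc.
by move=> v; apply: near_eq_derivable (fd v).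
Unshelve. all: by end_near. Qed.

Lemma iter_derive_add V W (U : set V) (f g : V -> W) : open U ->
  smooth_on U f -> smooth_on U g ->
  forall vs x, U x ->
  iter_derive (f \+ g) vs x = iter_derive f vs x + iter_derive g vs x.
Proof.
move=> oU sf sg; elim=> [//|v vs IH] x Ux /=.
rewrite (@near_eq_derive _ _ _ _ (iter_derive f vs + iter_derive g vs)).
  by rewrite deriveD //; [exact: (sf vs x Ux).2|exact: (sg vs x Ux).2].
near=> y; apply: IH; near: y; exact: open_nbhs_nbhs.
Unshelve. all: by end_near. Qed.

Lemma smooth_near V W (f : V -> W) (g : seq V -> V -> W) (U : set V) :
  open U -> (forall vs x, U x -> iter_derive f vs x = g vs x) ->
  (forall vs x, U x -> {for x, continuous (g vs)} /\
     forall v, derivable (g vs) x v) ->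
  smooth_on U f.
Proof.
move=> oU fg sg vs x Ux; have [gc gd] := sg vs x Ux.
have E : \near x, g vs x = iter_derive f vs x.
  near=> y; apply/esym/fg; near: y; exact: open_nbhs_nbhs.
split; first exact: near_eq_continuous gc.
by move=> v; apply: near_eq_derivable (gd v).
Unshelve. all: by end_near. Qed.

Lemma smooth_add V W (U : set V) (f g : V -> W) : open U ->
  smooth_on U f -> smooth_on U g -> smooth_on U (f \+ g).
Proof.
move=> oU sf sg.
apply: (smooth_near (g := fun vs => iter_derive f vs + iter_derive g vs)) => //.
  exact: iter_derive_add.
move=> vs x Ux; have [fc fd] := sf vs x Ux; have [gc gd] := sg vs x Ux.
split; first exact: (@continuousD _ _ _ (iter_derive f vs)).
by move=> v; exact: derivableD.
Qed.

Lemma smooth_lin_post V W X (l : {linear W -> X}) (U : set V) (f : V -> W) :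
  continuous l -> open U -> smooth_on U f -> smooth_on U (l \o f).
Proof.
move=> lc oU sf.
apply: (smooth_near (g := fun vs => l \o iter_derive f vs)) => //.
  elim=> [//|v vs IH] x Ux /=.
  rewrite (@near_eq_derive _ _ _ _ (l \o iter_derive f vs)).
    by have [_ ->] := is_derive_lin_post lc ((sf vs x Ux).2 v).
  near=> y; apply: IH; near: y; exact: open_nbhs_nbhs.
move=> vs x Ux; have [fc fd] := sf vs x Ux; split.
  by apply: continuous_comp; [exact: fc|exact: lc].
by move=> v; have [] := is_derive_lin_post lc (fd v).
Unshelve. all: by end_near. Qed.

Lemma smoothW V W (U U' : set V) (f : V -> W) :
  U' `<=` U -> smooth_on U f -> smooth_on U' f.
Proof. by move=> UU sf vs x /UU; exact: sf. Qed.

Lemma smooth_derivable V W (U : set V) (f : V -> W) x v :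
  smooth_on U f -> U x -> derivable f x v.
Proof. by move=> sf Ux; exact: (sf [::] x Ux).2. Qed.

Lemma smooth_opp V W (U : set V) (f : V -> W) : open U ->
  smooth_on U f -> smooth_on U (fun x => - f x).
Proof.
move=> oU sf; apply: (@smooth_lin_post _ _ _ (-%R : {linear W -> W})) => //.
exact: opp_continuous.
Qed.

Section RowMx.
Variables m n : nat.

Definition row_mxl (x : 'rV[R]_m) : 'rV[R]_(m + n) := row_mx x 0.
Definition row_mxr (y : 'rV[R]_n) : 'rV[R]_(m + n) := row_mx 0 y.

Fact row_mxl_linear : linear row_mxl.
Proof. by move=> a x y; rewrite /row_mxl scale_row_mx add_row_mx scaler0 addr0. Qed.
HB.instance Definition _ :=
  GRing.isLinear.Build R 'rV[R]_m 'rV[R]_(m + n) _ row_mxl row_mxl_linear.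

Fact row_mxr_linear : linear row_mxr.
Proof. by move=> a x y; rewrite /row_mxr scale_row_mx add_row_mx scaler0 addr0. Qed.
HB.instance Definition _ :=
  GRing.isLinear.Build R 'rV[R]_n 'rV[R]_(m + n) _ row_mxr row_mxr_linear.

Lemma continuous_row_mxl : continuous row_mxl.
Proof.
move=> u A /nbhs_ballP[e /= e0 eA].
apply/nbhs_ballP; exists e => //= v [_ uv]; apply: eA; split => // i j.
rewrite /row_mxl !mxE; case: splitP => k _; first exact: uv.
by rewrite !mxE; exact: ballxx.
Qed.

Lemma continuous_row_mxr : continuous row_mxr.
Proof.
move=> u A /nbhs_ballP[e /= e0 eA].
apply/nbhs_ballP; exists e => //= v [_ uv]; apply: eA; split => // i j.
rewrite /row_mxr !mxE; case: splitP => k _; last exact: uv.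
by rewrite !mxE; exact: ballxx.
Qed.

End RowMx.

Definition prod_fun m n m' n' (f : 'rV[R]_m -> 'rV[R]_m')
    (g : 'rV[R]_n -> 'rV[R]_n') (x : 'rV[R]_(m + n)) : 'rV[R]_(m' + n') :=
  row_mx (f (lsubmx x)) (g (rsubmx x)).

Definition prod_set m n (A : set 'rV[R]_m) (B : set 'rV[R]_n) :
    set 'rV[R]_(m + n) :=
  [set x | A (lsubmx x) /\ B (rsubmx x)].

Lemma open_prod_set m n (A : set 'rV[R]_m) (B : set 'rV[R]_n) :
  open A -> open B -> open (prod_set A B).
Proof.
move=> oA oB; apply: openI.
  by apply: (@open_comp _ _ (@lsubmx _ _ _ _)) => // x _; exact: continuous_lsubmx.
by apply: (@open_comp _ _ (@rsubmx _ _ _ _)) => // x _; exact: continuous_rsubmx.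
Qed.

Section ProdFun.
Variables (m n m' n' : nat).
Variables (f : 'rV[R]_m -> 'rV[R]_m') (g : 'rV[R]_n -> 'rV[R]_n').

Lemma prod_funE : prod_fun f g =
  (@row_mxl m' n' \o (f \o lsubmx)) + (@row_mxr m' n' \o (g \o rsubmx)).
Proof.
apply/funext => x.
transitivity (row_mx (f (lsubmx x)) 0 + row_mx 0 (g (rsubmx x))); last by [].
by rewrite add_row_mx addr0 add0r.
Qed.

Lemma smooth_prod_fun A B : open A -> open B ->
  smooth_on A f -> smooth_on B g -> smooth_on (prod_set A B) (prod_fun f g).
Proof.
move=> oA oB sf sg; have oAB := open_prod_set oA oB.
rewrite prod_funE; apply: smooth_add => //.
  apply: smooth_lin_post => //; first exact: continuous_row_mxl.
  apply: (@smoothW _ _ (lsubmx @^-1` A)); first by move=> x [].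
  by apply: smooth_lin_pre => //; exact: continuous_lsubmx.
apply: smooth_lin_post => //; first exact: continuous_row_mxr.
apply: (@smoothW _ _ (rsubmx @^-1` B)); first by move=> x [].
by apply: smooth_lin_pre => //; exact: continuous_rsubmx.
Qed.

Lemma derive_prod_fun x v :
  derivable f (lsubmx x) (lsubmx v) -> derivable g (rsubmx x) (rsubmx v) ->
  'D_v (prod_fun f g) x =
    row_mx ('D_(lsubmx v) f (lsubmx x)) ('D_(rsubmx v) g (rsubmx x)).
Proof.
move=> df dg; rewrite prod_funE.
have := is_derive_lin_post (@continuous_row_mxl m' n') (derivable_lin_pre df).
have := is_derive_lin_post (@continuous_row_mxr m' n') (derivable_lin_pre dg).
move=> [d1 e1] [d2 e2]; rewrite deriveD // e1 e2.
by rewrite !derive_lin_pre /row_mxl /row_mxr add_row_mx addr0 add0r.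
Qed.

End ProdFun.

End SmoothTheory.

Section Constructions.
Variable R : realType.

Lemma prod_hausdorff (S T : topologicalType) :
  hausdorff_space S -> hausdorff_space T -> hausdorff_space (S * T)%type.
Proof.
move=> hS hT [p p'] [q q'] cl; congr pair.
- apply: hS => A B nA nB.
  have [] := cl (A `*` setT) (B `*` setT).
  + by exists (A, setT) => //; split => //; exact: filterT.
  + by exists (B, setT) => //; split => //; exact: filterT.
  + by move=> [x y] [[/= Ax _] [/= Bx _]]; exists x.
- apply: hT => A B nA nB.
  have [] := cl (setT `*` A) (setT `*` B).
  + by exists (setT, A) => //; split => //; exact: filterT.
  + by exists (setT, B) => //; split => //; exact: filterT.
  + by move=> [x y] [[/= _ Ay] [/= _ By]]; exists y.
Qed.

Lemma open_prodX (S T : topologicalType) (A : set S) (B : set T) :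
  open A -> open B -> open (A `*` B).
Proof.
rewrite !openE => oA oB [x y] [/= Ax By].
by exists (A, B) => //; split; [exact: oA|exact: oB].
Qed.

Lemma prod_second_countable (S T : topologicalType) :
  @second_countable S -> @second_countable T ->
  @second_countable (S * T)%type.
Proof.
move=> [B cB [Bo Bb]] [C cC [Co Cb]].
exists ((fun D : set S * set T => D.1 `*` D.2) @` (B `*` C)).
  by apply: sub_countable (card_image_le _ _) _; exact: countableX.
split.
  by move=> _ [[U V] [/= BU CV] <-]; apply: open_prodX; [exact: Bo|exact: Co].
move=> [x y] A [[P Q] [/= nP nQ] PQA].
have [U [/= BU Ux] UP] := Bb x P nP; have [V [/= CV Vy] VQ] := Cb y Q nQ.
exists (U `*` V) => /=; first by split; [exists (U, V)|].
by move=> [a b] [/= Ua Vb]; apply: PQA; split; [exact: UP|exact: VQ].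
Qed.

Section Charts.
Variables (S T : topologicalType) (m n : nat).
Variables (c : chart R S m) (d : chart R T n).

Definition prod_source : set (S * T) := chart_source c `*` chart_source d.
Definition prod_coord (p : S * T) : 'rV[R]_(m + n) :=
  row_mx (chart_fun c p.1) (chart_fun d p.2).
Definition prod_point (x : 'rV[R]_(m + n)) : S * T :=
  (chart_inv c (lsubmx x), chart_inv d (rsubmx x)).

Lemma prod_coord_image (A : set S) (B : set T) :
  prod_coord @` (A `*` B) = prod_set (chart_fun c @` A) (chart_fun d @` B).
Proof.
apply/seteqP; split => [_ [[p q] [/= Ap Bq] <-]|x [[p Ap pE] [q Bq qE]]].
  by split; rewrite /prod_coord ?row_mxKl ?row_mxKr; [exists p|exists q].
by exists (p, q) => //; rewrite /prod_coord /= pE qE hsubmxK.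
Qed.

Lemma prod_source_open : open prod_source.
Proof. by apply: open_prodX; exact: chart_source_open. Qed.

Lemma prod_target_open : open (prod_coord @` prod_source).
Proof.
rewrite prod_coord_image; apply: open_prod_set; exact: chart_target_open.
Qed.

Lemma prod_coordK p : prod_source p -> prod_point (prod_coord p) = p.
Proof.
case: p => p q [/= cp dq].
by rewrite /prod_point /prod_coord row_mxKl row_mxKr !chart_funK.
Qed.

Lemma prod_coord_continuous p : prod_source p -> {for p, continuous prod_coord}.
Proof.
case: p => p q [/= cp dq].
have -> : prod_coord = (@row_mxl R m n \o (chart_fun c \o fst)) \+
    (@row_mxr R m n \o (chart_fun d \o snd)).
  by apply/funext => z; rewrite /= /row_mxl /row_mxr add_row_mx addr0 add0r.
apply: (@continuousD _ _ _ (@row_mxl R m n \o (chart_fun c \o fst))).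
  apply: continuous_comp; last exact: continuous_row_mxl.
  apply: continuous_comp; first exact: cvg_fst.
  exact: chart_fun_continuous.
apply: continuous_comp; last exact: continuous_row_mxr.
apply: continuous_comp; first exact: cvg_snd.
exact: chart_fun_continuous.
Qed.

Lemma prod_point_continuous x :
  (prod_coord @` prod_source) x -> {for x, continuous prod_point}.
Proof.
rewrite prod_coord_image => -[cx dx].
have cl : {for x, continuous (chart_inv c \o @lsubmx R 1 m n)}.
  apply: continuous_comp; first exact: continuous_lsubmx.
  exact: chart_inv_continuous.
have dr : {for x, continuous (chart_inv d \o @rsubmx R 1 m n)}.
  apply: continuous_comp; first exact: continuous_rsubmx.
  exact: chart_inv_continuous.
exact: (cvg_pair cl dr).
Qed.

Definition prod_chart : chart R (S * T)%type (m + n) :=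
  Chart prod_source_open prod_target_open prod_coordK prod_coord_continuous
    prod_point_continuous.

Lemma prod_chart_target :
  chart_target prod_chart = prod_set (chart_target c) (chart_target d).
Proof. exact: prod_coord_image. Qed.

End Charts.

Lemma local_dom_id (S : topologicalType) m n (c : chart R S m) (d : chart R S n) :
  local_dom c d id =
  chart_target c `&` (chart_inv c @^-1` chart_source d).
Proof.
apply/seteqP; split => [_ [p [cp dp] <-]|_ [[p cp <-]]] /=.
  by split; [exists p|rewrite /preimage /= chart_funK].
by rewrite /preimage /= chart_funK // => dp; exists p.
Qed.

Lemma open_local_dom_id (S : topologicalType) m n (c : chart R S m)
  (d : chart R S n) : open (local_dom c d id).
Proof.
rewrite local_dom_id openE => x [cx dx].
apply: filterI; first by apply: open_nbhs_nbhs; split => //; exact: chart_target_open.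
apply: (chart_inv_continuous cx).
by apply: open_nbhs_nbhs; split => //; exact: chart_source_open.
Qed.

Lemma local_dom_prod (S T : topologicalType) m n m' n'
    (c : chart R S m) (c' : chart R T n) (d : chart R S m') (d' : chart R T n') :
  local_dom (prod_chart c c') (prod_chart d d') id =
  prod_set (local_dom c d id) (local_dom c' d' id).
Proof.
rewrite /local_dom /= -prod_coord_image; congr image.
by apply/seteqP; split => -[p q] [[? ?] [? ?]].
Qed.

Lemma local_rep_prod (S T : topologicalType) m n m' n'
    (c : chart R S m) (c' : chart R T n) (d : chart R S m') (d' : chart R T n') :
  local_rep (prod_chart c c') (prod_chart d d') id =
  prod_fun (local_rep c d id) (local_rep c' d' id).
Proof. by []. Qed.

Section ProdManifold.
Variables M N : manifold R.

Definition prod_atlas (i : atlas_index M * atlas_index N) :=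
  prod_chart (atlas i.1) (atlas i.2).

Lemma prod_atlas_cover p : exists i, chart_source (prod_atlas i) p.
Proof.
have [i ip] := atlas_cover p.1; have [j jp] := atlas_cover p.2.
by exists (i, j).
Qed.

Lemma prod_atlas_compatible i j :
  smooth_on (local_dom (prod_atlas i) (prod_atlas j) id)
            (local_rep (prod_atlas i) (prod_atlas j) id).
Proof.
rewrite local_dom_prod local_rep_prod.
by apply: smooth_prod_fun; try exact: open_local_dom_id; exact: atlas_compatible.
Qed.

Definition prod_manifold : manifold R :=
  Manifold (prod_hausdorff (@manifold_hausdorff R M) (@manifold_hausdorff R N))
    (prod_second_countable (@manifold_second_countable R M)
                           (@manifold_second_countable R N))
    prod_atlas_cover prod_atlas_compatible.

End ProdManifold.

Lemma gram_block m n (A : 'M[R]_m) (B : 'M[R]_n) (v w : 'rV[R]_(m + n)) :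
  gram (block_mx A 0 0 B) v w =
  gram A (lsubmx v) (lsubmx w) + gram B (rsubmx v) (rsubmx w).
Proof.
rewrite /gram -[in LHS](hsubmxK v) -[in LHS](hsubmxK w).
by rewrite mul_row_block !mulmx0 addr0 add0r tr_row_mx mul_row_col mxE.
Qed.

Lemma gramN n (A : 'M[R]_n) v w : gram (- A) v w = - gram A v w.
Proof. by rewrite /gram mulmxN mulNmx mxE. Qed.

Section ProdSymplectic.
Variables M N : symplectic_manifold R.

Definition prod_form (i : atlas_index (prod_manifold M N))
    (x : 'rV[R]_(dim (prod_manifold M N))) : 'M[R]_(dim (prod_manifold M N)) :=
  block_mx (form i.1 (lsubmx x)) 0 0 (form i.2 (rsubmx x)).

Lemma gram_prod_form i v w : (fun x => gram (prod_form i x) v w : R) =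
  ((fun y => gram (form i.1 y) (lsubmx v) (lsubmx w) : R) \o lsubmx) \+
  ((fun z => gram (form i.2 z) (rsubmx v) (rsubmx w) : R) \o rsubmx).
Proof. by apply/funext => x; rewrite gram_block. Qed.

Lemma prod_targetE i : chart_target (@atlas R (prod_manifold M N) i) =
  prod_set (chart_target (@atlas R M i.1)) (chart_target (@atlas R N i.2)).
Proof. exact: prod_chart_target. Qed.

Lemma prod_form_smooth i v w :
  smooth_on (chart_target (atlas i)) (fun x => gram (prod_form i x) v w : R).
Proof.
rewrite gram_prod_form prod_targetE; apply: smooth_add.
- by apply: open_prod_set; exact: chart_target_open.
- apply: (@smoothW _ _ _ (lsubmx @^-1` chart_target (@atlas R M i.1))).
    by move=> x [].
  by apply: smooth_lin_pre; [exact: continuous_lsubmx|exact: form_smooth].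
- apply: (@smoothW _ _ _ (rsubmx @^-1` chart_target (@atlas R N i.2))).
    by move=> x [].
  by apply: smooth_lin_pre; [exact: continuous_rsubmx|exact: form_smooth].
Qed.

Lemma prod_form_alternating i x : chart_target (atlas i) x ->
  (prod_form i x)^T = - prod_form i x.
Proof.
rewrite prod_targetE => -[Mx Nx].
rewrite /prod_form tr_block_mx opp_block_mx !trmx0 !oppr0.
by rewrite !form_alternating.
Qed.

Lemma prod_form_nondegenerate i x : chart_target (atlas i) x ->
  prod_form i x \in unitmx.
Proof.
rewrite prod_targetE => -[Mx Nx].
rewrite unitmxE det_ublock unitrM -!unitmxE.
by rewrite !form_nondegenerate.
Qed.

Lemma derive_prod_form i x u v w : chart_target (atlas i) x ->
  'D_u (fun y => gram (prod_form i y) v w : R) x =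
  'D_(lsubmx u) (fun y => gram (form i.1 y) (lsubmx v) (lsubmx w) : R)
     (lsubmx x) +
  'D_(rsubmx u) (fun y => gram (form i.2 y) (rsubmx v) (rsubmx w) : R)
     (rsubmx x).
Proof.
rewrite prod_targetE => -[Mx Nx]; rewrite gram_prod_form deriveD.
- by rewrite !derive_lin_pre.
- by apply: derivable_lin_pre; exact: smooth_derivable (form_smooth _ _) Mx.
- by apply: derivable_lin_pre; exact: smooth_derivable (form_smooth _ _) Nx.
Qed.

Lemma prod_form_closed i x : chart_target (atlas i) x -> forall u v w,
  'D_u (fun y => gram (prod_form i y) v w : R) x +
  'D_v (fun y => gram (prod_form i y) w u : R) x +
  'D_w (fun y => gram (prod_form i y) u v : R) x = 0.
Proof.
move=> ix u v w; rewrite !derive_prod_form //.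
move: ix; rewrite prod_targetE => -[Mx Nx].
have aca (a a' b b' c c' : R) :
    a + a' + (b + b') + (c + c') = a + b + c + (a' + b' + c').
  by rewrite (addrACA a) (addrACA (a + b)).
by rewrite aca !form_closed // addr0.
Qed.

Lemma prod_form_compatible i j x : local_dom (atlas i) (atlas j) id x ->
  forall v w, gram (prod_form i x) v w =
    gram (prod_form j (local_rep (atlas i) (atlas j) id x))
         ('D_v (local_rep (atlas i) (atlas j) id) x)
         ('D_w (local_rep (atlas i) (atlas j) id) x).
Proof.
rewrite local_dom_prod local_rep_prod => -[Mx Nx] v w.
have dM u : derivable (local_rep (@atlas R M i.1) (atlas j.1) id) (lsubmx x) u.
  exact: smooth_derivable (@atlas_compatible R M i.1 j.1) Mx.
have dN u : derivable (local_rep (@atlas R N i.2) (atlas j.2) id) (rsubmx x) u.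
  exact: smooth_derivable (@atlas_compatible R N i.2 j.2) Nx.
rewrite !derive_prod_fun // !gram_block !row_mxKl !row_mxKr.
by rewrite -!form_compatible.
Qed.

Definition tensor : symplectic_manifold R :=
  SymplecticManifold prod_form_smooth prod_form_alternating
    prod_form_nondegenerate prod_form_closed prod_form_compatible.

End ProdSymplectic.

Section Opposite.
Variable M : symplectic_manifold R.

Definition opp_form (i : atlas_index M) (x : 'rV[R]_(dim M)) : 'M[R]_(dim M) :=
  - form i x.

Lemma gram_opp_form i v w : (fun x => gram (opp_form i x) v w : R) =
  (fun x => - (gram (form i x) v w : R)).
Proof. by apply/funext => x; rewrite gramN. Qed.

Lemma opp_form_smooth i v w :
  smooth_on (chart_target (atlas i)) (fun x => gram (opp_form i x) v w : R).
Proof.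
rewrite gram_opp_form; apply: smooth_opp; last exact: form_smooth.
exact: chart_target_open.
Qed.

Lemma opp_form_alternating i x : chart_target (atlas i) x ->
  (opp_form i x)^T = - opp_form i x.
Proof. by move=> ix; rewrite /opp_form linearN /= form_alternating. Qed.

Lemma opp_form_nondegenerate i x : chart_target (atlas i) x ->
  opp_form i x \in unitmx.
Proof.
move=> ix; rewrite /opp_form -scaleN1r unitmxZ ?unitrN1 //.
exact: form_nondegenerate.
Qed.

Lemma opp_form_closed i x : chart_target (atlas i) x -> forall u v w,
  'D_u (fun y => gram (opp_form i y) v w : R) x +
  'D_v (fun y => gram (opp_form i y) w u : R) x +
  'D_w (fun y => gram (opp_form i y) u v : R) x = 0.
Proof.
move=> ix u v w; rewrite !gram_opp_form.
have D a b e : derivable (fun y => gram (form i y) a b : R) x e.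
  exact: smooth_derivable (form_smooth _ _) ix.
by rewrite !deriveN // -!opprD form_closed ?oppr0.
Qed.

Lemma opp_form_compatible i j x : local_dom (atlas i) (atlas j) id x ->
  forall v w, gram (opp_form i x) v w =
    gram (opp_form j (local_rep (atlas i) (atlas j) id x))
         ('D_v (local_rep (atlas i) (atlas j) id) x)
         ('D_w (local_rep (atlas i) (atlas j) id) x).
Proof. by move=> ix v w; rewrite !gramN -form_compatible. Qed.

Definition opposite : symplectic_manifold R :=
  SymplecticManifold opp_form_smooth opp_form_alternating
    opp_form_nondegenerate opp_form_closed opp_form_compatible.

End Opposite.

Lemma gram0 n (v w : 'rV[R]_n) : gram 0 v w = 0.
Proof. by rewrite /gram mulmx0 mul0mx mxE. Qed.

Lemma smooth_cst (V W : normedModType R) (U : set V) (a : W) :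
  smooth_on U (cst a).
Proof.
have E vs : exists b, iter_derive (cst a : V -> W) vs = cst b.
  elim: vs => [|v vs [b IH]]; first by exists a.
  by exists 0; rewrite /= IH; apply/funext => x; rewrite derive_cst.
move=> vs x _; have [b ->] := E vs.
by split; [exact: cst_continuous|move=> v; exact: derivable_cst].
Qed.

Definition point_type : topologicalType := discrete_topology unit.

Fact point_source_open : open [set: point_type].
Proof. exact: openT. Qed.
Fact point_target_open :
  open ((fun _ : point_type => 0 : 'rV[R]_0) @` [set: point_type]).
Proof.
suff -> : (fun _ : point_type => 0 : 'rV[R]_0) @` [set: point_type] = setT.
  exact: openT.
by apply/seteqP; split => // x _; exists tt => //; rewrite [x]thinmx0.
Qed.
Fact point_coordK (p : point_type) : [set: point_type] p -> tt = p.
Proof. by case: p. Qed.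
Fact point_coord_continuous (p : point_type) : [set: point_type] p ->
  {for p, continuous (fun _ : point_type => 0 : 'rV[R]_0)}.
Proof. by move=> _; exact: cst_continuous. Qed.
Fact point_inv_continuous (x : 'rV[R]_0) :
  ((fun _ : point_type => 0 : 'rV[R]_0) @` [set: point_type]) x ->
  {for x, continuous (fun _ : 'rV[R]_0 => tt : point_type)}.
Proof. by move=> _; exact: cst_continuous. Qed.

Definition point_chart : chart R point_type 0 :=
  Chart point_source_open point_target_open point_coordK
    point_coord_continuous point_inv_continuous.

Fact point_hausdorff : hausdorff_space point_type.
Proof. by move=> [] []. Qed.
Fact point_second_countable : @second_countable point_type.
Proof.
exists [set setT]; first exact: countable1.
split=> [_ ->|x A xA]; first exact: openT.
by exists setT => // -[] _; case: x xA => /nbhs_singleton.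
Qed.
Fact point_cover (p : point_type) : exists i : unit, chart_source point_chart p.
Proof. by exists tt. Qed.
Fact point_compatible (i j : unit) :
  smooth_on (local_dom point_chart point_chart id)
            (local_rep point_chart point_chart id).
Proof. exact: smooth_cst. Qed.

Definition point_manifold : manifold R :=
  @Manifold R point_type 0 unit (fun=> point_chart) point_hausdorff
    point_second_countable point_cover point_compatible.

Definition one_point : symplectic_manifold R.
Proof.
refine (@SymplecticManifold R point_manifold (fun _ _ => 0) _ _ _ _ _).
- by move=> i v w; rewrite gram0; exact: smooth_cst.
- by move=> i x _; rewrite trmx0 oppr0.
- by move=> i x _; rewrite unitmxE det_mx00 unitr1.
- by move=> i x _ u v w; rewrite !gram0 !derive_cst !addr0.
- by move=> i j x _ v w; rewrite !gram0.
Defined.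

End Constructions.

Section Relations.
Context {M N P A B C : Type}.

(* rcomp L' L is the composition written L' o L, i.e. first L, then L'. *)
Definition rcomp (L' : set (N * P)) (L : set (M * N)) : set (M * P) :=
  (fun q : (M * N) * (N * P) => (q.1.1, q.2.2)) @`
    ((L `*` L') `&` [set q | diagonal (q.1.2, q.2.1)]).

Definition rtensor (L1 : set (M * N)) (L2 : set (A * B)) :
    set ((M * A) * (N * B)) :=
  [set q | L1 (q.1.1, q.2.1) /\ L2 (q.1.2, q.2.2)].

Definition prod_assoc (p : (M * N) * P) : M * (N * P) :=
  (p.1.1, (p.1.2, p.2)).

End Relations.

Definition rebracket {M N P A B C : Type} (q : ((M * N) * P) * ((A * B) * C)) :
    (M * (N * P)) * (A * (B * C)) :=
  (prod_assoc q.1, prod_assoc q.2).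

Definition id_rel (R : realType) (M : symplectic_manifold R) : set (M * M) :=
  diagonal.
Arguments id_rel {R} M _.

Definition lagHom (R : realType) (M N : symplectic_manifold R) :
    set (set (M * N)) :=
  [set L | @lagrangian R (tensor (opposite M) N) L].
Arguments lagHom {R} M N _.

(* Main.v *)
From HB Require Import structures.
Require Import Defs.
From mathcomp Require Import all_boot all_order all_algebra.
From mathcomp Require Import all_classical all_reals all_analysis.
Local Open Scope classical_set_scope.
Local Open Scope card_scope.

(** The statements about relations and bijections hold for arbitrary sets and
    relations: composition and tensor product are defined by conditions on
    each component of a tuple, and regrouping the components regroups the
    conditions.

    The geometric content is the associativity of the tensor product of
    objects: re-bracketing (M x A) x X -> M x (A x X) is a symplectomorphism.
    In the product charts, re-bracketing a point re-brackets its coordinates,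
    and on row vectors of length (m + n) + p this is a cast of dimension
    ([rV_castA]), in particular a continuous linear map l. So the local
    expression of the re-bracketing in any two charts is a transition function
    of the target precomposed with l ([linear_in_charts_rep]). Its smoothness
    is then the compatibility of the atlas of the target, and the invariance of
    the symplectic form reduces, by the compatibility of the form of the target
    with its transition functions, to the invariance under l
    ([linear_in_charts_form]). The latter holds because both forms are
    block-diagonal with the same three blocks. The inverse map is treated in
    the same way, with the reverse cast. *)

Set Implicit Arguments.
Unset Strict Implicit.
Unset Printing Implicit Defensive.

Import GRing.Theory.
Import numFieldNormedType.Exports.

(** * Relations *)

Section Relations.
Context {M N P A B C X Y : Type}.

Lemma rcomp_rtensor (L1 : set (M * A)) (L2 : set (N * B))
    (L3 : set (A * X)) (L4 : set (B * Y)) :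
  rcomp (rtensor L3 L4) (rtensor L1 L2)
    = rtensor (rcomp L3 L1) (rcomp L4 L2).
Proof.
apply/seteqP; split.
  move=> _ [[[[m n] [a b]] [[a' b'] [x y]]] [[[/= h1 h2] [/= h3 h4]] ab] <-].
  case: ab h3 h4 => <- <- h3 h4.
  by split; [exists ((m, a), (a, x))|exists ((n, b), (b, y))].
move=> [[m n] [x y]] [[[[m' a] [a' x']] [[/= h1 h3] /= aa] [mm xx]]].
move=> [[[n' b] [b' y']] [[/= h2 h4] /= bb] [nn yy]].
rewrite /diagonal /= in aa bb; subst.
by exists (((m, n), (a', b')), ((a', b'), (x, y))).
Qed.

Lemma rebracket_rtensor (L1 : set (M * A)) (L2 : set (N * B))
    (L3 : set (P * C)) :
  rebracket @` rtensor (rtensor L1 L2) L3 = rtensor L1 (rtensor L2 L3).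
Proof.
apply/seteqP; split=> [_ [[[[m n] p] [[a b] c]] [[h1 h2] h3] <-] //|].
move=> [[m [n p]] [a [b c]]] [h1 [h2 h3]].
by exists (((m, n), p), ((a, b), c)).
Qed.

Lemma rtensor_diagonal :
  rtensor diagonal diagonal = diagonal :> set ((M * N) * (M * N)).
Proof.
apply/seteqP; split=> -[[m n] [m' n']]; rewrite /rtensor /diagonal /=.
  by move=> -[-> ->].
by move=> -[-> ->].
Qed.

Lemma card_unit_prod : [set: unit * A] #= [set: A].
Proof.
rewrite (_ : setT = pair tt @` setT); first by apply: inj_card_eq => x y _ _ [].
by apply/seteqP; split=> // -[[] x] _; exists x.
Qed.

Lemma card_prod_unit : [set: A * unit] #= [set: A].
Proof.
rewrite (_ : setT = pair^~ tt @` setT).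
  by apply: inj_card_eq => x y _ _ [].
by apply/seteqP; split=> // -[x []] _; exists x.
Qed.

Lemma card_diagonal_rtensor (L : set (M * N)) :
  rtensor (@diagonal unit) L #= L.
Proof.
rewrite (_ : rtensor _ _ =
  (fun p : M * N => ((tt, p.1), (tt, p.2))) @` L); last first.
  apply/seteqP; split=> [[[[] m] [[] n]] [_ Lmn]|_ [[m n] Lmn <-] //].
  by exists (m, n).
by apply: inj_card_eq => -[? ?] [? ?] _ _ /= [-> ->].
Qed.

Lemma card_rtensor_diagonal (L : set (M * N)) :
  rtensor L (@diagonal unit) #= L.
Proof.
rewrite (_ : rtensor _ _ =
  (fun p : M * N => ((p.1, tt), (p.2, tt))) @` L); last first.
  apply/seteqP; split=> [[[m []] [n []]] [Lmn _]|_ [[m n] Lmn <-] //].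
  by exists (m, n).
by apply: inj_card_eq => -[? ?] [? ?] _ _ /= [-> ->].
Qed.

End Relations.

(** * Re-bracketing coordinates *)

Section Cast.
Variable R : realType.
Local Open Scope ring_scope.

Definition rV_cast m n (e : m = n) (x : 'rV[R]_m) : 'rV[R]_n :=
  castmx (erefl, e) x.

Fact rV_cast_linear m n (e : m = n) : linear (rV_cast e).
Proof. by case: n / e => a x y; rewrite /rV_cast !castmx_id. Qed.
HB.instance Definition _ m n (e : m = n) :=
  GRing.isLinear.Build R 'rV[R]_m 'rV[R]_n _ (rV_cast e) (rV_cast_linear e).

Lemma continuous_rV_cast m n (e : m = n) : continuous (rV_cast e).
Proof.
case: n / e; have -> : rV_cast (erefl m) = idfun.
  by apply/funext => x; rewrite /rV_cast castmx_id.
by move=> x; exact: cvg_id.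
Qed.

Lemma rV_castA m n p (e : (m + n + p = m + (n + p))%N)
    (x : 'rV[R]_(m + n + p)) :
  rV_cast e x =
    row_mx (lsubmx (lsubmx x)) (row_mx (rsubmx (lsubmx x)) (rsubmx x)).
Proof.
by rewrite row_mxA !hsubmxK /rV_cast (eq_irrelevance e (esym (addnA _ _ _))).
Qed.

Lemma rV_castAr m n p (e : (m + (n + p) = m + n + p)%N)
    (x : 'rV[R]_(m + (n + p))) :
  rV_cast e x =
    row_mx (row_mx (lsubmx x) (lsubmx (rsubmx x))) (rsubmx (rsubmx x)).
Proof.
rewrite -{1}[x]hsubmxK -{1}[rsubmx x]hsubmxK row_mxA /rV_cast castmx_comp.
exact: castmx_id.
Qed.

End Cast.

(** * Maps that are linear in charts *)

(** The last clause is imposed on all vectors, also outside the chart targets: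
    the local expressions of f are then equal, as functions and not only on an
    open set, to transition functions of N precomposed with l, so that
    derivatives can be compared by rewriting. *)
Definition linear_in_charts (R : realType) (M N : manifold R) (f : M -> N)
    (phi : atlas_index M -> atlas_index N)
    (l : 'rV[R]_(Defs.dim M) -> 'rV[R]_(Defs.dim N)) : Prop :=
  [/\ forall i p, chart_source (@atlas R M i) p ->
        chart_source (@atlas R N (phi i)) (f p),
      forall i p, chart_source (@atlas R M i) p ->
        chart_fun (@atlas R N (phi i)) (f p) = l (chart_fun (@atlas R M i) p) &
      forall i x, chart_inv (@atlas R N (phi i)) (l x) =
        f (chart_inv (@atlas R M i) x)].

Section LinearInCharts.
Variable R : realType.

Section Smooth.
Variables (M N : manifold R) (f : M -> N).
Variables (phi : atlas_index M -> atlas_index N).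
Variables (l : {linear 'rV[R]_(Defs.dim M) -> 'rV[R]_(Defs.dim N)}).
Hypothesis fl : linear_in_charts f phi l.

Lemma linear_in_charts_rep i j :
  local_rep (@atlas R M i) (@atlas R N j) f =
  local_rep (@atlas R N (phi i)) (@atlas R N j) id \o l.
Proof.
by case: fl => _ _ finv; apply/funext => x; rewrite /local_rep /= finv.
Qed.

Lemma linear_in_charts_dom i j :
  local_dom (@atlas R M i) (@atlas R N j) f `<=`
  l @^-1` local_dom (@atlas R N (phi i)) (@atlas R N j) id.
Proof.
case: fl => fsrc ffun _ _ [p [ip jfp] <-].
by rewrite /preimage /= -ffun //; exists (f p) => //; split=> //; exact: fsrc.
Qed.

Lemma linear_in_charts_smooth :
  continuous f -> continuous l -> smooth_map f.
Proof.
move=> fc lc; split=> // i j; rewrite linear_in_charts_rep.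
apply: smoothW (@linear_in_charts_dom i j) _.
by apply: smooth_lin_pre => //; exact: atlas_compatible.
Qed.

End Smooth.

(** By the chain rule for l, the derivative of f in the charts i and j along v
    is the derivative of a transition function of N along l v; the form of N is
    compatible with that transition function, so invariance in arbitrary charts
    follows from invariance under l alone. *)
Lemma linear_in_charts_form (M N : symplectic_manifold R) (f : M -> N)
    (phi : atlas_index M -> atlas_index N)
    (l : {linear 'rV[R]_(Defs.dim M) -> 'rV[R]_(Defs.dim N)}) :
  linear_in_charts f phi l ->
  (forall i x v w,
    gram (Defs.form i x) v w = gram (Defs.form (phi i) (l x)) (l v) (l w)) ->
  forall i j x, local_dom (@atlas R M i) (@atlas R N j) f x ->
    forall v w, gram (Defs.form i x) v w =
      gram (Defs.form j (local_rep (atlas i) (atlas j) f x))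
           ('D_v (local_rep (@atlas R M i) (@atlas R N j) f) x)
           ('D_w (local_rep (@atlas R M i) (@atlas R N j) f) x).
Proof.
move=> fl lform i j x ijx v w.
rewrite (linear_in_charts_rep fl) !derive_lin_pre lform /=.
exact/form_compatible/(linear_in_charts_dom fl).
Qed.

End LinearInCharts.

(** * Associativity of the tensor product of objects *)

Section Associativity.
Variables (R : realType) (M A X : symplectic_manifold R).

Let T1 := tensor (tensor M A) X.
Let T2 := tensor M (tensor A X).

Let dimA : Defs.dim T1 = Defs.dim T2 :=
  esym (addnA (Defs.dim M) (Defs.dim A) (Defs.dim X)).

Lemma prod_assoc_linear :
  @linear_in_charts R T1 T2 prod_assoc prod_assoc (rV_cast dimA).
Proof.
split.
- by move=> [[i j] k] [[m a] x] [[im ja] kx].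
- move=> [[i j] k] [[m a] x] _.
  by rewrite rV_castA /= /prod_coord /= !(row_mxKl, row_mxKr).
- move=> [[i j] k] x.
  by rewrite rV_castA /= /prod_point /= /prod_point !(row_mxKl, row_mxKr).
Qed.

Lemma prodAr_linear :
  @linear_in_charts R T2 T1 unstable.prodAr unstable.prodAr
    (rV_cast (esym dimA)).
Proof.
split.
- by move=> [i [j k]] [m [a x]] [im [ja kx]].
- move=> [i [j k]] [m [a x]] _.
  by rewrite rV_castAr /= /prod_coord /= !(row_mxKl, row_mxKr).
- move=> [i [j k]] x.
  by rewrite rV_castAr /= /prod_point /= /prod_point !(row_mxKl, row_mxKr).
Qed.

Lemma prod_assoc_symplectomorphism : @symplectomorphism R T1 T2 prod_assoc.
Proof.
split.
- apply: (linear_in_charts_smooth prod_assoc_linear).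
    exact: prodA_continuous.
  exact: continuous_rV_cast.
- exists unstable.prodAr.
  split; [exact: unstable.prodAK|exact: unstable.prodArK|].
  apply: (linear_in_charts_smooth prodAr_linear).
    exact: prodAr_continuous.
  exact: continuous_rV_cast.
- apply: (linear_in_charts_form prod_assoc_linear).
  move=> [[i j] k] x v w; rewrite /= !rV_castA /prod_form !gram_block /=.
  by rewrite !(row_mxKl, row_mxKr) addrA.
Qed.

End Associativity.

Theorem proposition4 (R : realType) :
  (* (1) *)
  (forall (M N A B X Y : symplectic_manifold R)
      (L1 : set (M * A)) (L2 : set (N * B))
      (L3 : set (A * X)) (L4 : set (B * Y)),
    lagHom M A L1 -> lagHom N B L2 -> lagHom A X L3 -> lagHom B Y L4 ->
    rcomp (rtensor L3 L4) (rtensor L1 L2)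
      = rtensor (rcomp L3 L1) (rcomp L4 L2)) /\
  (* (2) *)
  (forall M N : symplectic_manifold R,
    rtensor (id_rel M) (id_rel N) = id_rel (tensor M N)) /\
  (* (3) *)
  (forall M A X : symplectic_manifold R,
    @symplectomorphism R (tensor (tensor M A) X) (tensor M (tensor A X))
      prod_assoc) /\
  (* (4) *)
  (forall (M N P A B C : symplectic_manifold R)
      (L1 : set (M * A)) (L2 : set (N * B)) (L3 : set (P * C)),
    lagHom M A L1 -> lagHom N B L2 -> lagHom P C L3 ->
    rebracket @` rtensor (rtensor L1 L2) L3 = rtensor L1 (rtensor L2 L3)) /\
  (* (5) *)
  (forall A : symplectic_manifold R,
    ([set: tensor (one_point R) A] #= [set: A]) /\
    ([set: A] #= [set: tensor A (one_point R)])) /\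
  (forall (M N : symplectic_manifold R) (L : set (M * N)),
    lagHom M N L ->
    (rtensor (id_rel (one_point R)) L #= L) /\
    (L #= rtensor L (id_rel (one_point R)))).
Proof.
split; first by move=> *; exact: rcomp_rtensor.
split; first by move=> M N; exact: rtensor_diagonal.
split; first exact: prod_assoc_symplectomorphism.
split; first by move=> *; exact: rebracket_rtensor.
split=> [A|M N L _]; split.
- exact: card_unit_prod.
- by rewrite card_eq_sym; exact: card_prod_unit.
- exact: card_diagonal_rtensor.
- by rewrite card_eq_sym; exact: card_rtensor_diagonal.
Qed.
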